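(* Let $S$ be a commutative valuation ring (not necessarily an integral domain) and let $R$ be a ring (not necessarily commutative). Let $f:S\to R$ be a ring homomorphism (not necessarily unitary) such that $f[S]\subseteq Z(R)$. Then $f$ satisfies SGB (strong going between). In particular, every $S$-algebra satisfies SGB over $S$.
   Context: $\subset$ means proper inclusion. A commutative valuation ring is a commutative ring (with $1$) whose set of ideals is totally ordered by containment. $Z(R)$ is the center of $R$, and $\operatorname{Spec}(R)$ is the set of prime (two-sided) ideals of $R$. An ideal $Q$ of $R$ is lying over $P\subseteq S$ if $P=f^{-1}[Q]$. The homomorphism $f$ satisfies SGB if for any $P_1\subset P_2\subset P_3$ in $\operatorname{Spec}(S)$ and any $Q_1\subset Q_3$ in $\operatorname{Spec}(R)$ such that $Q_1$ is lying over $P_1$ and $Q_3$ is lying over $P_3$, there exists $Q_2\in\operatorname{Spec}(R)$ with $Q_1\subset Q_2\subset Q_3$ and $Q_2$ lying over $P_2$. An $S$-algebra is a ring $R$ with a unitary ring homomorphism $f:S\to R$, $f(s)=s\cdot1_R$, with $f[S]\subseteq Z(R)$; it satisfies SGB over $S$ if this $f$ does. *)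

(* Defs.v *)
From mathcomp Require Import all_boot all_algebra.
From mathcomp Require Import classical_sets.

Set Implicit Arguments.
Unset Strict Implicit.
Unset Printing Implicit Defensive.

Import GRing.Theory.

Local Open Scope ring_scope.
Local Open Scope classical_set_scope.

(* Closure under opposites follows from closure under multiplication by -1. *)
Definition two_sided_ideal (R : pzRingType) (I : set R) : Prop :=
  [/\ I 0,
      forall x y, I x -> I y -> I (x + y),
      forall a x, I x -> I (a * x) &
      forall x a, I x -> I (x * a)].

(* The ideal product AB consists of finite sums of products a * b; as P is an
   ideal, AB is contained in P as soon as all the products a * b are. *)
Definition Spec (R : pzRingType) : set (set R) :=
  [set P | [/\ two_sided_ideal P,
               P `<` setT &
               forall A B : set R, two_sided_ideal A -> two_sided_ideal B ->
                 [set a * b | a in A & b in B] `<=` P ->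
                 A `<=` P \/ B `<=` P]].

Definition ring_center (R : pzRingType) : set R :=
  [set z | forall x, GRing.comm z x].

Arguments ring_center R : clear implicits.

Definition valuation_ring (S : comPzRingType) : Prop :=
  forall I J : set S, two_sided_ideal I -> two_sided_ideal J ->
    I `<=` J \/ J `<=` I.

Definition lying_over (S R : pzRingType) (f : S -> R) (Q : set R) (P : set S)
  : Prop := P = f @^-1` Q.

Definition SGB (S R : pzRingType) (f : S -> R) : Prop :=
  forall P1 P2 P3 : set S,
    Spec P1 -> Spec P2 -> Spec P3 -> P1 `<` P2 -> P2 `<` P3 ->
  forall Q1 Q3 : set R,
    Spec Q1 -> Spec Q3 -> Q1 `<` Q3 ->
    lying_over f Q1 P1 -> lying_over f Q3 P3 ->
  exists Q2 : set R,
    [/\ Spec Q2, Q1 `<` Q2, Q2 `<` Q3 & lying_over f Q2 P2].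

(* Main.v *)
Require Import Defs.
From mathcomp Require Import all_boot all_algebra.
From mathcomp Require Import boolp classical_sets.

(** Fix the data of the going-between problem: primes [P1], [P2], [P3] of [S]
    and primes [Q1], [Q3] of [R] over the outer two.  A prime [Q] of [R]
    containing [Q1] solves it as soon as it contains [f p] for [p] in [P2] and
    contains no element of
      M = (R \ Q3)  together with the products  f s * x, s \notin P2, x \notin Q3.
    Avoiding [R \ Q3] keeps [Q] inside [Q3]; avoiding the products keeps [f s]
    out of [Q] for [s \notin P2].  As [f s] is central and the complement of a
    prime ideal is an m-system, so is [M], and an ideal maximal among those
    which avoid an m-system is prime ([prime_avoiding_m_system]).  It remains
    to see that the ideal [Q1 + f(P2) R] does not meet [M].

    This is where the valuation hypothesis enters, twice.  Any two elements of
    [P2] being comparable for divisibility, each element of [Q1 + f(P2) R] has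
    the form [q + f p * r] with a single [p] ([extended_ideal]).  If it equals
    [f s * x] with [s \notin P2], then [s] divides [p], say [p = s * t] with
    [t] in [P2], so that [f s * (x - f t * r)] lies in [Q1].  Now [f s] is
    central and outside [Q1], hence cancels modulo [Q1]; thus [x] is in
    [Q1 + f(P2) R], which is contained in [Q3]. *)

Set Implicit Arguments.
Unset Strict Implicit.
Unset Printing Implicit Defensive.

Import GRing.Theory.

Local Open Scope ring_scope.
Local Open Scope classical_set_scope.

(** * Two-sided ideals and prime ideals *)

Section Ideals.
Variable R : pzRingType.
Implicit Types (A B I M P Q : set R) (a b x y : R).

Lemma ideal_sum A B : two_sided_ideal A -> two_sided_ideal B ->
  two_sided_ideal [set a + b | a in A & b in B].
Proof.
move=> [A0 AD AMl AMr] [B0 BD BMl BMr]; split.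
- by exists 0 => //; exists 0 => //; rewrite addr0.
- move=> _ _ [a Aa [b Bb <-]] [a' Aa' [b' Bb' <-]].
  exists (a + a'); first exact: AD.
  by exists (b + b'); [exact: BD | rewrite addrACA].
- move=> c _ [a Aa [b Bb <-]].
  exists (c * a); first exact: AMl.
  by exists (c * b); [exact: BMl | rewrite mulrDr].
- move=> _ c [a Aa [b Bb <-]].
  exists (a * c); first exact: AMr.
  by exists (b * c); [exact: BMr | rewrite mulrDl].
Qed.

(** The ideals generated by [a] and [b] can be replaced by larger ones that
    need no finite sums: the [y] with [a R y] inside [P] form a two-sided ideal
    [B] containing [b], the [x] with [x R B] inside [P] form a two-sided ideal
    containing [a], and their product is inside [P]. *)
Lemma prime_elementwise P a b : Spec P ->
  (forall r, P (a * r * b)) -> P a \/ P b.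
Proof.
move=> [[P0 PD PMl PMr] _ primeP] aRb.
pose B : set R := [set y | forall r, P (a * r * y)].
pose A : set R := [set x | forall r y, B y -> P (x * r * y)].
have idB : two_sided_ideal B.
  split.
  - by move=> r; rewrite mulr0.
  - by move=> x y Bx By r; rewrite mulrDr; apply: PD.
  - by move=> c x Bx r; rewrite mulrA -(mulrA a); exact: Bx.
  - by move=> x c Bx r; rewrite mulrA; apply: PMr.
have idA : two_sided_ideal A.
  split.
  - by move=> r y _; rewrite !mul0r.
  - by move=> x x' Ax Ax' r y By; rewrite !mulrDl; apply: PD;
      [exact: Ax | exact: Ax'].
  - by move=> c x Ax r y By; rewrite -!mulrA; apply: PMl; rewrite mulrA;
      exact: Ax.
  - by move=> x c Ax r y By; rewrite -(mulrA x); exact: Ax.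
have AB : [set x * y | x in A & y in B] `<=` P.
  by move=> _ [x Ax [y By <-]]; rewrite -(mulr1 x); exact: Ax.
have [sAP|sBP] := primeP _ _ idA idB AB.
- by left; apply: sAP => r y; exact.
- by right; apply: sBP.
Qed.

Definition m_system M := forall a b, M a -> M b -> exists r, M (a * r * b).

Lemma m_system_setC_prime P : Spec P -> m_system (~` P).
Proof.
move=> primeP a b Pa Pb; apply: contrapT => /forallNP nM.
have aRb r : P (a * r * b) by apply: contrapT; exact: nM.
by case: (prime_elementwise primeP aRb).
Qed.

(** For central [z] the products [z * r * x] are left multiples of [z * x], so
    that membership of this one product already puts [z R x] inside [P]. *)
Lemma prime_central_cancel P z x : Spec P ->
  ring_center R z -> ~ P z -> P (z * x) -> P x.
Proof.
move=> primeP Zz Pz Pzx; have [[_ _ PMl _] _ _] := primeP.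
have zRx r : P (z * r * x) by rewrite Zz -mulrA; exact: PMl.
by case: (prime_elementwise primeP zRx).
Qed.

(** If ideals [A] and [B] are not inside a maximal [Q], then [Q + A] and
    [Q + B] both meet [M], and so does [(Q + A)(Q + B)] by the m-system
    property; hence [A B] is not inside [Q]. *)
Lemma maximal_avoiding_prime M Q : m_system M -> M !=set0 ->
  two_sided_ideal Q -> Q `<=` ~` M ->
  (forall J, two_sided_ideal J -> J `<=` ~` M -> Q `<=` J -> J `<=` Q) ->
  Spec Q.
Proof.
move=> mM [m0 Mm0] idQ QM maxQ; have [Q0 QD QMl QMr] := idQ.
have meetM A : two_sided_ideal A -> ~ (A `<=` Q) ->
    exists q a, [/\ Q q, A a & M (q + a)].
  move=> idA nAQ; have [A0 _ _ _] := idA.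
  apply: contrapT => nex; apply: nAQ.
  apply: (@subset_trans _ [set q + a | q in Q & a in A]).
    by move=> a Aa; exists 0 => //; exists a => //; rewrite add0r.
  apply: maxQ; first exact: ideal_sum.
    by move=> _ [q Qq [a Aa <-]] Mqa; apply: nex; exists q, a.
  by move=> q Qq; exists q => //; exists 0 => //; rewrite addr0.
split=> //.
  by split=> // /(_ m0 I) Qm0; exact: QM Mm0.
move=> A B idA idB AB; have [_ _ _ AMr] := idA.
apply: contrapT => /not_orP[nAQ nBQ].
have [q [a [Qq Aa Mqa]]] := meetM _ idA nAQ.
have [q' [b [Qq' Bb Mqb]]] := meetM _ idB nBQ.
have [r Mr] := mM _ _ Mqa Mqb.
apply: QM Mr; rewrite mulrDr; apply: (QD); first exact: QMl.
rewrite !mulrDl; apply: (QD); first by do 2!apply: (QMr).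
by apply: AB; exists (a * r); [exact: AMr | exists b].
Qed.

Lemma prime_avoiding_m_system I M : m_system M -> M !=set0 ->
  two_sided_ideal I -> I `<=` ~` M ->
  exists Q, [/\ Spec Q, I `<=` Q & Q `<=` ~` M].
Proof.
move=> mM M0 idI IM; have [I0 _ _ _] := idI.
pose D X := [/\ two_sided_ideal X, I `<=` X & X `<=` ~` M].
(* The empty set is added to the candidates as the union of the empty chain. *)
have [|Q [[Q0|[idQ IQ QM]] maxQ]] := @Zorn_bigcup R [set X | X = set0 \/ D X].
- move=> F FD Ftot.
  have [[X0 [FX0 DX0]]|noD] := pselect (exists X, F X /\ D X); last first.
    left; apply/seteqP; split=> // x [X FX Xx].
    have [X0|DX] := FD _ FX; first by rewrite X0 in Xx.
    by apply: noD; exists X.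
  have DF X x : F X -> X x -> D X.
    by move=> FX Xx; have [X_0|] := FD _ FX; first rewrite X_0 in Xx.
  right; have [[X00 _ _ _] IX0 _] := DX0; split.
  + split.
    * by exists X0.
    * move=> x y [X FX Xx] [Y FY Yy].
      have [sXY|sYX] := Ftot _ _ FX FY.
        have [[_ YD _ _] _ _] := DF _ _ FY Yy.
        by exists Y => //; apply: YD => //; exact: sXY.
      have [[_ XD _ _] _ _] := DF _ _ FX Xx.
      by exists X => //; apply: XD => //; exact: sYX.
    * move=> a x [X FX Xx]; have [[_ _ XM _] _ _] := DF _ _ FX Xx.
      by exists X => //; exact: XM.
    * move=> x a [X FX Xx]; have [[_ _ _ XM] _ _] := DF _ _ FX Xx.
      by exists X => //; exact: XM.
  + by move=> x Ix; exists X0 => //; exact: IX0.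
  + by move=> x [X FX Xx]; have [_ _ XnM] := DF _ _ FX Xx; exact: XnM.
- exfalso; apply: (maxQ I); last by right; split.
  by rewrite Q0; split=> // /(_ 0 I0).
- exists Q; split=> //; apply: maximal_avoiding_prime M0 idQ QM _ => //.
  move=> J idJ JM QJ; apply: contrapT => nJQ.
  apply: (maxQ J); first by split.
  by right; split=> //; exact: subset_trans QJ.
Qed.

End Ideals.

(** * Divisibility in a valuation ring *)

Lemma valuation_ring_dvd (S : comPzRingType) (x y : S) : valuation_ring S ->
  (exists t, y = x * t) \/ (exists t, x = y * t).
Proof.
move=> hS.
have idp (z : S) : two_sided_ideal (range ( *%R z)).
  split.
  - by exists 0; rewrite ?mulr0.
  - by move=> _ _ [a _ <-] [b _ <-]; exists (a + b); rewrite ?mulrDr.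
  - by move=> c _ [a _ <-]; exists (c * a); rewrite // mulrCA.
  - by move=> _ c [a _ <-]; exists (a * c); rewrite // mulrA.
have self (z : S) : range ( *%R z) z by exists 1; rewrite ?mulr1.
have [sxy|syx] := hS _ _ (idp x) (idp y).
- by have [t _ <-] := sxy _ (self x); right; exists t.
- by have [t _ <-] := syx _ (self y); left; exists t.
Qed.

(** * Strong going between *)

Section CentralMorphism.
Variables (S : comPzRingType) (hS : valuation_ring S).
Variables (R : pzRingType) (f : {additive S -> R}).
Hypothesis fM : {morph f : x y / x * y}.
Hypothesis fZ : range f `<=` ring_center R.

Let fC s x : f s * x = x * f s.
Proof. by have /(_ x) := fZ (imageT f s). Qed.

Definition extended_ideal (Q1 : set R) (P2 : set S) : set R :=
  [set z | exists q p r, [/\ Q1 q, P2 p & z = q + f p * r]].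

(** Of two elements [p], [p'] of [P2] one divides the other, so the sum of
    [f p * r] and [f p' * r'] is again a multiple of one of [f p], [f p']. *)
Lemma extended_ideal_ideal Q1 P2 : two_sided_ideal Q1 -> P2 0 ->
  two_sided_ideal (extended_ideal Q1 P2).
Proof.
move=> [Q0 QD QMl QMr] P0; split.
- by exists 0, 0, 0; split=> //; rewrite mulr0 addr0.
- move=> _ _ [q [p [r [Qq Pp ->]]]] [q' [p' [r' [Qq' Pp' ->]]]].
  have [[t ->]|[t ->]] := valuation_ring_dvd p p' hS.
  + exists (q + q'), p, (r + f t * r'); split=> //; first exact: QD.
    by rewrite addrACA fM mulrDr !mulrA.
  + exists (q + q'), p', (f t * r + r'); split=> //; first exact: QD.
    by rewrite addrACA fM mulrDr !mulrA.
- move=> a _ [q [p [r [Qq Pp ->]]]].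
  exists (a * q), p, (a * r); split=> //; first exact: QMl.
  by rewrite mulrDr !mulrA fC.
- move=> _ a [q [p [r [Qq Pp ->]]]].
  exists (q * a), p, (r * a); split=> //; first exact: QMr.
  by rewrite mulrDl !mulrA.
Qed.

(** The elements outside [Q3] are adjoined separately because [f 1] may differ
    from [1], in which case they need not be products of this form. *)
Definition avoided (P2 : set S) (Q3 : set R) : set R :=
  ~` Q3 `|` [set f s * x | s in ~` P2 & x in ~` Q3].

Lemma m_system_avoided P2 Q3 : Spec P2 -> Spec Q3 -> m_system (avoided P2 Q3).
Proof.
move=> primeP2 primeQ3.
have mQ3 := m_system_setC_prime primeQ3.
have nP2 s t : ~ P2 s -> ~ P2 t -> ~ P2 (s * t).
  move=> Ps Pt Pst; apply: Pt.
  apply: (prime_central_cancel primeP2 _ Ps Pst) => x; exact: mulrC.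
move=> a b [Qa|[s Ps [x Qx <-]]] [Qb|[t Pt [y Qy <-]]].
- by have [r Mr] := mQ3 _ _ Qa Qb; exists r; left.
- have [r Mr] := mQ3 _ _ Qa Qy; exists r; right.
  exists t => //; exists (a * r * y) => //.
  by rewrite mulrA fC -!mulrA.
- have [r Mr] := mQ3 _ _ Qx Qb; exists r; right.
  by exists s => //; exists (x * r * b) => //; rewrite !mulrA.
- have [r Mr] := mQ3 _ _ Qx Qy; exists r; right.
  exists (s * t); first exact: nP2.
  exists (x * r * y) => //.
  by rewrite fM -!mulrA; congr (_ * _); rewrite (fC t y) fC !mulrA.
Qed.

(** The cancellation step: modulo [Q1] the factor [f s] can be divided out of
    [f s * x = q + f (s * t) * r]. *)
Lemma extended_ideal_avoids Q1 P2 Q3 : Spec Q1 -> Spec P2 -> Spec Q3 ->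
  f @^-1` Q1 `<=` P2 -> P2 `<=` f @^-1` Q3 -> Q1 `<=` Q3 ->
  extended_ideal Q1 P2 `<=` ~` avoided P2 Q3.
Proof.
move=> primeQ1 primeP2 [[_ Q3D _ Q3M] _ _] Q1P2 P2Q3 Q1Q3.
have [idQ1 _ _] := primeQ1; have [[_ _ _ P2M] _ _] := primeP2.
have memQ3 q p r : Q1 q -> P2 p -> Q3 (q + f p * r).
  by move=> Qq Pp; apply: Q3D; [exact: Q1Q3 | apply: Q3M; exact: P2Q3].
move=> _ [q [p [r [Qq Pp ->]]]] [|[s Ps [x Qx]]]; first by apply; exact: memQ3.
have [[t p_st]|[t s_pt]] := valuation_ring_dvd s p hS; last first.
  by move=> _; apply: Ps; rewrite s_pt; exact: P2M.
have Pt : P2 t.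
  apply: (prime_central_cancel primeP2 _ Ps); last by rewrite -p_st.
  by move=> y; exact: mulrC.
rewrite p_st fM => fsx; apply: Qx.
have Qxt : Q1 (x - f t * r).
  apply: (prime_central_cancel primeQ1 (fZ (imageT f s))).
    by move=> Qs; apply: Ps; exact: Q1P2.
  by rewrite mulrBr fsx mulrA addrK.
by rewrite -(subrK (f t * r) x); exact: memQ3.
Qed.

Lemma central_morphism_SGB : SGB f.
Proof.
move=> P1 P2 P3 primeP1 primeP2 primeP3 P12 P23 Q1 Q3 primeQ1 primeQ3 Q13 e1 e3.
have [sP12 nP12] := P12; have [sP23 nP23] := P23; have [sQ13 _] := Q13.
have [idQ1 _ _] := primeQ1; have [[P20 _ _ _] _ _] := primeP2.
have [_ [_ nQ3] _] := primeQ3; have [Q10 _ _ _] := idQ1.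
have [x0 Qx0] : exists x, ~ Q3 x.
  by apply/existsNP => Q3T; apply: nQ3 => x _; exact: Q3T.
have [||||Q2 [primeQ2 IQ2 Q2M]] := @prime_avoiding_m_system R
  (extended_ideal Q1 P2) (avoided P2 Q3).
- exact: m_system_avoided.
- by exists x0; left.
- exact: extended_ideal_ideal.
- by apply: extended_ideal_avoids => //; [rewrite -e1 | rewrite -e3].
have [[_ _ _ Q2mul] _ _] := primeQ2.
have sQ12 : Q1 `<=` Q2.
  by move=> q Qq; apply: IQ2; exists q, 0, 0; split=> //; rewrite mulr0 addr0.
have sQ23 : Q2 `<=` Q3.
  by move=> x Qx; apply: contrapT => nQx; apply: (Q2M x) => //; left.
have e2 : lying_over f Q2 P2.
  apply/seteqP; split=> s.
    by move=> Ps; apply: IQ2; exists 0, s, 1; split=> //; rewrite mulr1 add0r.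
  (* The factor [x0], outside [Q3], turns [f s] into an avoided product. *)
  move=> Qs; apply: contrapT => Ps; apply: (Q2M (f s * x0)).
    exact: Q2mul.
  by right; exists s => //; exists x0.
exists Q2; split=> //; split=> // sQ.
- by apply: nP12; rewrite e1 e2 => s; exact: sQ.
- by apply: nP23; rewrite e2 e3 => s; exact: sQ.
Qed.

End CentralMorphism.

Theorem theorem3p7 (S : comPzRingType) (hS : valuation_ring S) :
  (forall (R : pzRingType) (f : {additive S -> R}),
     {morph f : x y / x * y} -> range f `<=` ring_center R -> SGB f)
  /\
  (forall (R : pzRingType) (f : {rmorphism S -> R}),
     range f `<=` ring_center R -> SGB f).
Proof.
split=> [R f fM fZ|R f fZ]; apply: central_morphism_SGB => //.
exact: rmorphM.
Qed.
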